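(* Let $G=\operatorname{GL}_2(q)$, where $q$ is a prime power. Let $\chi_q^{(n)}$ be an irreducible complex character of $G$ of degree $q$. Suppose $\mu:\mathbb{F}_q^\times\to\mathbb{C}^\times$ is the multiplicative character such that $\chi_q^{(n)}$ is afforded by $\operatorname{St}\otimes(\mu\circ\det)$. Let $\rho_\mu$ be an irreducible $\mathbb{Q}$-representation of $G$ affording the character $\Omega(\mu\circ\det)$. Then $\operatorname{St}\otimes\rho_\mu$ is an irreducible rational representation of $G$ affording the character $\Omega(\chi_q^{(n)})$.
   Context: For a finite group $G$ and an irreducible complex character $\chi$ of $G$, $\mathbb{Q}(\chi)$ is the field generated over $\mathbb{Q}$ by the values of $\chi$, $m_{\mathbb{Q}}(\chi)$ is the Schur index of $\chi$ over $\mathbb{Q}$, and $$\Omega(\chi)=m_{\mathbb{Q}}(\chi)\sum_{\sigma\in\operatorname{Gal}(\mathbb{Q}(\chi)/\mathbb{Q})}\chi^{\sigma},\qquad \chi^\sigma(g)=\sigma(\chi(g)).$$ Let $\mathbb{P}^1(\mathbb{F}_q)$ be the set of $1$-dimensional subspaces of $\mathbb{F}_q^2$, with the action $\begin{pmatrix}a&b\\c&d\end{pmatrix}\cdot[x:y]=[ax+by:cx+dy]$ of $G$. The Steinberg representation $\operatorname{St}$ is the $q$-dimensional representation of $G$ on the space of functions $f:\mathbb{P}^1(\mathbb{F}_q)\to\mathbb{C}$ with $\sum_{P}f(P)=0$, with action $(g f)(P)=f(g^{-1}\cdot P)$. It is realizable over $\mathbb{Q}$ (use $\mathbb{Q}$-valued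 functions), and in $\operatorname{St}\otimes\rho_\mu$ this rational form is meant, with tensor product over $\mathbb{Q}$. Here $(\mu\circ\det)(g)=\mu(\det g)$. As $\mu$ ranges over the $q-1$ characters of $\mathbb{F}_q^\times$, the representations $\operatorname{St}\otimes(\mu\circ\det)$ are pairwise inequivalent and exhaust the irreducible complex representations of $G$ of degree $q$; $\chi_q^{(n)}$ ($0\le n\le q-2$) is the paper's notation for their characters. *)

(* Defs.v *)
From HB Require Import structures.
From Stdlib Require ClassicalEpsilon.
From mathcomp Require Import all_boot all_order all_fingroup all_algebra.
From mathcomp Require Import all_solvable all_field all_character.
Set Implicit Arguments.
Unset Strict Implicit.
Unset Printing Implicit Defensive.
Import Order.TTheory GroupScope GRing.Theory Num.Theory.
Local Open Scope ring_scope.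

(* Complex representations and characters are taken over algC, the algebraic  *)
(* numbers: every complex representation of a finite group has a form over    *)
(* algC, and algC is the coefficient field of the character library.          *)

Section LeftModule.

(* A left action of G by endomorphisms of vT that preserves U gives a matrix  *)
(* representation: column j of the matrix of g holds the coordinates of the   *)
(* image under g of the j-th basis vector of U.                               *)

Variables (K : fieldType) (vT : vectType K) (U : {vspace vT}).
Variables (gT : finGroupType) (G : {group gT}) (act : gT -> 'End(vT)).
Hypothesis actU : forall g, (act g @: U <= U)%VS.
Hypothesis act1 : forall u, act 1%g u = u.
Hypothesis actM : forall g h u, act (g * h)%g u = act g (act h u).

Definition left_mx (g : gT) : 'M[K]_(\dim U) :=
  \matrix_(i, j) coord (vbasis U) i (act g (vbasis U)`_j).

Fact left_mx_repr : mx_repr G left_mx.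
Proof.
have bU (j : 'I_(\dim U)) : (vbasis U)`_j \in U.
  by rewrite vbasis_mem // mem_nth // size_tuple.
have frU := basis_free (vbasisP U).
split=> [|g h _ _]; apply/matrixP=> i j.
  by rewrite [LHS]mxE [RHS]mxE act1 coord_free // eq_sym.
rewrite [LHS]mxE [RHS]mxE actM.
have -> : act h (vbasis U)`_j =
    \sum_k coord (vbasis U) k (act h (vbasis U)`_j) *: (vbasis U)`_k.
  exact: coord_vbasis (subvP (actU h) _ (memv_img _ (bU j))).
rewrite !linear_sum /=; apply: eq_bigr => k _.
by rewrite !linearZ /= [X in _ = X * _]mxE [X in _ = _ * X]mxE mulrC.
Qed.

Definition left_repr := MxRepresentation left_mx_repr.

End LeftModule.

Section ProjectiveLine.

Variable F : finFieldType.

Definition is_line (L : {set 'cV[F]_2}) : bool :=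
  [exists v : 'cV[F]_2, (v != 0) && (L == [set a *: v | a : F])].

Definition P1 : Type := {L : {set 'cV[F]_2} | is_line L}.
HB.instance Definition _ := Finite.on P1.

Definition line_img (g : {'GL_2[F]}) (L : {set 'cV[F]_2}) : {set 'cV[F]_2} :=
  [set GLval g *m v | v in L].

Fact line_img_is_line g (P : P1) : is_line (line_img g (val P)).
Proof.
case: P => L /= /existsP[v /andP[nz_v /eqP->]].
apply/existsP; exists (GLval g *m v); apply/andP; split.
  apply: contraNneq nz_v => gv0.
  by rewrite -[v](mulKmx (GL_unitmx g)) gv0 mulmx0.
apply/eqP/setP=> w; apply/imsetP/imsetP=> [[_ /imsetP[a _ ->] ->]|[a _ ->]].
  by exists a => //; rewrite scalemxAr.
by exists (a *: v); [apply: imset_f | rewrite scalemxAr].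
Qed.

Definition P1_act (g : {'GL_2[F]}) (P : P1) : P1 :=
  Sub (line_img g (val P)) (line_img_is_line g P).

Fact P1_act1 P : P1_act 1%g P = P.
Proof.
apply: val_inj => /=; apply/setP=> w; apply/imsetP/idP=> [[v Lv ->]|Lw].
  by rewrite GL_1E mul1mx.
by exists w; rewrite // GL_1E mul1mx.
Qed.

Fact P1_actM g h P : P1_act (g * h)%g P = P1_act g (P1_act h P).
Proof.
apply: val_inj => /=; apply/setP=> w; apply/imsetP/imsetP=> [[v Lv ->]|].
  by exists (GLval h *m v); rewrite ?imset_f // GL_MxE mulmxA.
by case=> _ /imsetP[v Lv ->] ->; exists v; rewrite // GL_MxE mulmxA.
Qed.

End ProjectiveLine.

Section Steinberg.

Variables (F : finFieldType) (K : fieldType).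

Notation P1_fun := {ffun P1 F -> K^o}.

Definition P1_sum (f : P1_fun) : K^o := \sum_P f P.

Fact P1_sum_is_linear : linear P1_sum.
Proof.
move=> a f h; rewrite /P1_sum scaler_sumr -big_split /=.
by apply: eq_bigr => P _; rewrite !ffunE.
Qed.
HB.instance Definition _ :=
  GRing.isLinear.Build K P1_fun K^o _ P1_sum P1_sum_is_linear.

Definition St_space : {vspace P1_fun} := lker (linfun P1_sum).

Definition P1_translate (g : {'GL_2[F]}) (f : P1_fun) : P1_fun :=
  [ffun P => f (P1_act g^-1 P)].

Fact P1_translate_is_linear g : linear (P1_translate g).
Proof. by move=> a f h; apply/ffunP=> P; rewrite !ffunE. Qed.
HB.instance Definition _ g :=
  GRing.isLinear.Build K P1_fun P1_fun _ (P1_translate g)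
    (P1_translate_is_linear g).

Definition St_act (g : {'GL_2[F]}) : 'End(P1_fun) := linfun (P1_translate g).

Fact St_actU g : (St_act g @: St_space <= St_space)%VS.
Proof.
apply/subvP=> _ /memv_imgP[f Sf ->]; rewrite memv_ker !lfunE /=.
move: Sf; rewrite memv_ker lfunE /= /P1_sum => /eqP sum0.
apply/eqP; rewrite -[RHS]sum0.
rewrite [RHS](reindex (P1_act g^-1)) /=.
  by apply: eq_bigr => P _; rewrite ffunE.
by exists (P1_act g) => P _; rewrite -P1_actM ?mulVg ?mulgV P1_act1.
Qed.

Fact St_act1 f : St_act 1%g f = f.
Proof. by rewrite lfunE /=; apply/ffunP=> P; rewrite ffunE invg1 P1_act1. Qed.

Fact St_actM g h f : St_act (g * h)%g f = St_act g (St_act h f).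
Proof.
by rewrite !lfunE /=; apply/ffunP=> P; rewrite !ffunE invMg P1_actM.
Qed.

Definition Steinberg : mx_representation K 'GL_2[F] (\dim St_space) :=
  left_repr 'GL_2[F]%G St_actU St_act1 St_actM.

End Steinberg.

Section DetCharacter.

Variables (F : finFieldType) (mu : 'CF([set: {unit F}])).
Hypothesis lin_mu : mu \is a linear_char.

Fact GL_det_unit (g : {'GL_2[F]}) : \det (GLval g) \is a GRing.unit.
Proof. by rewrite -unitmxE GL_unitmx. Qed.

Definition GL2_det (g : {'GL_2[F]}) : {unit F} := FinRing.unit F (GL_det_unit g).

Fact mu_det_mx_repr :
  mx_repr 'GL_2[F] (fun g => (mu (GL2_det g))%:M : 'M[algC]_1).
Proof.
split=> [|g h _ _].
  rewrite (_ : GL2_det 1 = 1%g) ?lin_char1 //.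
  by apply: val_inj; rewrite /= det1.
rewrite (_ : GL2_det (g * h)%g = (GL2_det g * GL2_det h)%g); last first.
  by apply: val_inj; rewrite /= det_mulmx.
by rewrite lin_charM ?inE // scalar_mxM.
Qed.

Definition mu_det_repr : mx_representation algC 'GL_2[F] 1 :=
  MxRepresentation mu_det_mx_repr.

End DetCharacter.

Section Omega.

Variables (gT : finGroupType) (G : {group gT}).

Definition values_field (L : fieldExtType rat) (s : gT -> L) : {subfield L} :=
  <<1 & [seq s g | g in G]>>%AS.

(* chi is afforded by a representation over a number field E, embedded in     *)
(* algC by iota, with [E : Q(chi)] = d. Since iota (\tr (rE g)) = chi g, the  *)
(* traces of rE generate the copy of Q(chi) inside E.                         *)
Definition realizable_in_degree (chi : 'CF(G)) (d : nat) : Prop :=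
  exists (E : fieldExtType rat) (iota : {rmorphism E -> algC}) (n : nat)
         (rE : mx_representation E G n),
    cfRepr (map_repr iota rE) = chi /\
    d = \dim_(values_field (fun g => \tr (rE g))) {:E}.

Definition is_schur_index (chi : 'CF(G)) (m : nat) : Prop :=
  realizable_in_degree chi m /\
  forall d, realizable_in_degree chi d -> (m <= d)%N.

Definition schur_index (chi : 'CF(G)) : nat :=
  ClassicalEpsilon.epsilon (inhabits 0%N) (is_schur_index chi).

Fact realizable_char (chi : 'CF(G)) :
  chi \is a character -> exists d, realizable_in_degree chi d.
Proof.
case/char_reprP=> [[n rG] -> /=].
pose s := [seq rG p.1 p.2.1 p.2.2 | p : gT * ('I_n * 'I_n)].
have [E [iota [s1 Ds1 _]]] := num_field_exists s.
have [p _ iotaK] := num_field_proj iota.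
have rGK g i j : iota (p (rG g i j)) = rG g i j.
  have: rG g i j \in map iota s1 by rewrite Ds1 (image_f _ (x := (g, (i, j)))).
  by case/mapP=> x _ ->; rewrite iotaK.
pose r g : 'M[E]_n := \matrix_(i, j) p (rG g i j).
have iota_r g : map_mx iota (r g) = rG g by apply/matrixP=> i j; rewrite !mxE.
have r_repr : mx_repr G r.
  split=> [|g h Gg Gh]; apply: (map_mx_inj (f := iota)).
    by rewrite iota_r repr_mx1 map_mx1.
  by rewrite map_mxM !iota_r repr_mxM.
exists (\dim_(values_field (fun g => \tr (r g))) {:E}).
exists E, iota, n, (MxRepresentation r_repr); split=> //.
by apply/cfunP=> g; rewrite !cfunE map_reprE /= iota_r.
Qed.

Fact schur_indexP (chi : 'CF(G)) :
  chi \is a character -> is_schur_index chi (schur_index chi).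
Proof.
move=> chiP; apply: ClassicalEpsilon.epsilon_spec.
have [d0] := realizable_char chiP.
have [k] := ubnP d0; elim: k => // k IHk in d0 * => /ltnSE le_d0k Rd0.
have [[d lt_d Rd]|min_d0] :=
  Classical_Prop.classic (exists2 d, (d < d0)%N & realizable_in_degree chi d).
  by apply: (IHk d) => //; apply: leq_trans lt_d le_d0k.
exists d0; split=> // d Rd; rewrite leqNgt; apply/negP=> lt_d.
by case: min_d0; exists d.
Qed.

(* cyclo is the field Q(w), with w a primitive root of unity of order #|G|,   *)
(* and cycloC embeds it in algC. It contains all values of characters of G.   *)
Definition cyclo : splittingFieldType rat :=
  projT1 (sigT_of_sigT2 (group_num_field_exists G)).

Definition cycloC : {rmorphism cyclo -> algC} :=
  projT1 (sigT_of_sigT2 (projT3 (group_num_field_exists G))).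

Definition algC_cyclo : algC -> cyclo := s2val (num_field_proj cycloC).

Fact cycloCK : cancel cycloC algC_cyclo.
Proof. exact: s2valP' (num_field_proj cycloC). Qed.

Fact algC_cycloK (chi : 'CF(G)) :
  chi \is a character -> forall g, cycloC (algC_cyclo (chi g)) = chi g.
Proof.
move=> chiP g; suff [a <-]: exists a, cycloC a = chi g by rewrite cycloCK.
have [Gg|nGg] := boolP (g \in G); last by exists 0; rewrite rmorph0 cfun0.
have [w _ Qn_val] := projT3 (projT3 (group_num_field_exists G)).
by have [a Da] := Qn_val _ G _ chiP g (order_dvdG Gg); exists a.
Qed.

(* Q(chi), for a character chi, as a subfield of cyclo.                       *)
Definition char_field (chi : 'CF(G)) : {subfield cyclo} :=
  values_field (fun g => algC_cyclo (chi g)).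

(* m_Q(chi) times the sum of the Galois conjugates of chi; the conversions    *)
(* between algC and cyclo are inverse to each other on character values, by   *)
(* algC_cycloK.                                                               *)
Definition Omega (chi : 'CF(G)) (g : gT) : algC :=
  (schur_index chi)%:R *
    \sum_(sigma in 'Gal(char_field chi / 1)) cycloC (sigma (algC_cyclo (chi g))).

Definition rat_affords n (rG : mx_representation rat G n) (phi : gT -> algC) :=
  {in G, forall g, ratr (\tr (rG g)) = phi g}.

End Omega.

(* Main.v *)
(* The trace of St at g is the number of fixed points of g on P^1 minus 1, so  *)
(* it is a rational integer, and every a in F^* is the determinant of some g   *)
(* (namely diag(1, a), which fixes two points) with St(g) <> 0. With           *)
(* lambda = mu o det and chi = St * lambda this gives Q(chi) = Q(lambda), over *)
(* which both characters are realized; so both Schur indices are 1 and         *)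
(* Omega(chi) = St * Omega(lambda). As to irreducibility, a rational character *)
(* theta has the same multiplicity on all the conjugates of chi, and           *)
(* Omega(chi) contains chi just once: it cannot split as a sum of two nonzero  *)
(* rational characters, as both would contain chi.                             *)

(* St has integer values ([mxtrace_Steinberg]), nonzero at some element of each determinant
   ([exists_det_mxtrace_Steinberg_neq0]). Hence twisting lambda = mu o det by St keeps the field of
   values ([values_field_Steinberg_twist]), and both characters are realized over that field, with
   Schur index 1 ([schur_index_twist]). Galois conjugation fixes St, whence [Omega_twist].
   Irreducibility is then read off the character alone, by [Omega_irreducible], which holds for any
   irreducible character of Schur index 1. *)
Require Import Defs.
From mathcomp Require Import all_boot all_order all_fingroup all_algebra.
From mathcomp Require Import all_solvable all_field all_character.
Import Order.TTheory GroupScope GRing.Theory Num.Theory.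
Local Open Scope ring_scope.
Set Implicit Arguments.
Unset Strict Implicit.
Unset Printing Implicit Defensive.

(** * Values of the Steinberg character *)

Section SteinbergTrace.

Variables F : finFieldType.

Lemma span_is_line (v : 'cV[F]_2) : v != 0 -> is_line [set a *: v | a : F].
Proof. by move=> nz_v; apply/existsP; exists v; rewrite nz_v eqxx. Qed.

Definition line (v : 'cV[F]_2) (nz_v : v != 0) : P1 F :=
  Sub [set a *: v | a : F] (span_is_line nz_v).

Lemma P1_actK g : cancel (P1_act g) (@P1_act F g^-1).
Proof. by move=> P; rewrite -P1_actM mulVg P1_act1. Qed.

Lemma P1_actKV g : cancel (P1_act g^-1) (@P1_act F g).
Proof. by move=> P; rewrite -P1_actM mulgV P1_act1. Qed.

Lemma delta_neq0 i : delta_mx i 0 != 0 :> 'cV[F]_2.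
Proof.
by apply/eqP=> /matrixP/(_ i 0)/eqP; rewrite !mxE !eqxx oner_eq0.
Qed.

Lemma mxtrace_Steinberg (K : fieldType) (g : {'GL_2[F]}) :
  \tr (Steinberg F K g) = #|[set P | P1_act g P == P]|%:R - 1.
Proof.
pose P0 := line (delta_neq0 0).
(* Since [b P0] is 0, this is a spanning family of St rather than a basis; it expands a sum-zero f
   with coefficients f(P). *)
pose b P : {ffun P1 F -> K^o} := [ffun Q => (Q == P)%:R - (Q == P0)%:R].
have sum_delta (Q : P1 F) (f : P1 F -> K) : \sum_P f P * (Q == P)%:R = f Q.
  rewrite (bigD1 Q) //= eqxx mulr1 big1 ?addr0 // => P neP.
  by rewrite eq_sym (negPf neP) mulr0.
have sum1_delta (P : P1 F) : \sum_Q (Q == P)%:R = 1 :> K.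
  rewrite -[RHS](sum_delta P (fun=> 1)); apply: eq_bigr => Q _.
  by rewrite mul1r eq_sym.
have bU P : b P \in St_space F K.
  rewrite memv_ker lfunE /= /P1_sum; under eq_bigr do rewrite ffunE.
  by rewrite sumrB !sum1_delta subrr.
have f_sum f : f \in St_space F K -> f = \sum_P f P *: b P.
  rewrite memv_ker lfunE /= /P1_sum => /eqP sum0; apply/ffunP=> Q.
  rewrite sum_ffunE; under eq_bigr do rewrite !ffunE scalerBr.
  by rewrite sumrB (sum_delta Q f) -scaler_suml sum0 scale0r subr0.
set U := St_space F K in bU f_sum *.
have uU (j : 'I_(\dim U)) : (vbasis U)`_j \in U.
  by rewrite vbasis_mem // mem_nth // size_tuple.
(* Expand u_j along b, then recognize the coordinates of g b_P along u: this  *)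
(* turns sum_j u_j^*(g u_j) into sum_P (g b_P)(P).                            *)
have trE: \tr (Steinberg F K g) = \sum_P St_act K g (b P) P.
  transitivity (\sum_(j < \dim U) \sum_(P : P1 F)
      (vbasis U)`_j P * coord (vbasis U) j (St_act K g (b P))).
    apply: eq_bigr => j _; rewrite mxE [in LHS](f_sum _ (uU j)) !linear_sum /=.
    by apply: eq_bigr => P _; rewrite !linearZ.
  rewrite exchange_big /=; apply: eq_bigr => P _.
  have gbU := subvP (St_actU K g) _ (memv_img _ (bU P)).
  rewrite [in RHS](coord_vbasis gbU) sum_ffunE; apply: eq_bigr => j _.
  by rewrite ffunE mulrC.
rewrite trE; under eq_bigr do rewrite lfunE /= !ffunE.
rewrite sumrB; congr (_ - _).
  rewrite -sum1_card natr_sum [RHS]big_mkcond; apply: eq_bigr => P _.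
  rewrite inE; case: (P1_act g P =P P) => [gP | ngP].
    by rewrite -{1}gP P1_actK eqxx.
  by case: eqP => // e; case: ngP; rewrite -{1}e P1_actKV.
rewrite (reindex (P1_act g)) /=; last first.
  by exists (P1_act g^-1) => P _; rewrite ?P1_actK ?P1_actKV.
by under eq_bigr do rewrite P1_actK; exact: sum1_delta.
Qed.

Lemma P1_act_line (g : {'GL_2[F]}) v (nz_v : v != 0) c :
  c != 0 -> GLval g *m v = c *: v -> P1_act g (line nz_v) = line nz_v.
Proof.
move=> nz_c gv; apply: val_inj; apply/setP=> w /=.
apply/imsetP/imsetP=> [[_ /imsetP[a _ ->] ->] | [a _ ->]].
  by exists (a * c) => //; rewrite -scalemxAr gv scalerA.
exists ((a / c) *: v); first exact: imset_f.
by rewrite -scalemxAr gv scalerA divfK.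
Qed.

(** The matrix diag(1, a) fixes both coordinate axes, so its trace is a positive integer. *)
Lemma exists_det_mxtrace_Steinberg_neq0 (a : {unit F}) :
  exists g : {'GL_2[F]}, GL2_det g = a /\
    forall K : fieldType, has_pchar0 K -> \tr (Steinberg F K g) != 0.
Proof.
pose d : 'rV[F]_2 := \row_j (if j == 0 then 1 else val a).
have nz_a : val a != 0 by rewrite -unitfE; exact: (valP a).
have nz_d j : d 0 j != 0 by rewrite mxE; case: ifP; rewrite ?oner_eq0.
have det_d : \det (diag_mx d) = val a.
  by rewrite det_diag big_ord_recl big_ord1 !mxE mul1r.
have unit_d : \det (diag_mx d) \is a GRing.unit by rewrite det_d unitfE.
pose g : {'GL_2[F]} :=
  FinRing.unit _ (unit_d : (diag_mx d : 'M_2) \is a GRing.unit).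
exists g; split=> [|K charK]; first by apply: val_inj; rewrite /= det_d.
have fix_line i : P1_act g (line (delta_neq0 i)) = line (delta_neq0 i).
  apply: (P1_act_line _ (nz_d i)); apply/matrixP=> j k.
  rewrite mul_diag_mx !mxE andbC.
  by case: (j =P i) => [->|_]; rewrite ?andbF ?mulr0.
have two_fix : (1 < #|[set P | P1_act g P == P]|)%N.
  pose S := [set line (delta_neq0 0); line (delta_neq0 1)].
  apply: (leq_trans _ (subset_leq_card (_ : S \subset _))).
    rewrite cards2; suff -> : line (delta_neq0 0) != line (delta_neq0 1) by [].
    apply/eqP=> /(congr1 val)/setP/(_ (delta_mx 0 0)) /=.
    have -> : delta_mx 0 0 \in [set a *: (delta_mx 0 0 : 'cV[F]_2) | a : F].
      by apply/imsetP; exists 1; rewrite ?scale1r.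
    move/esym/imsetP=> [c _ /matrixP/(_ 0 0)/eqP].
    by rewrite !mxE !eqxx mulr0 oner_eq0.
  by apply/subsetP=> P /set2P[] ->; rewrite inE fix_line.
rewrite mxtrace_Steinberg -(prednK (ltnW two_fix)) -natr1 addrK.
by rewrite (iffLR (pcharf0P K) charK) -lt0n -ltnS prednK // ltnW.
Qed.

Lemma rmorph_mxtrace_Steinberg (K L : fieldType) (f : {rmorphism K -> L}) g :
  f (\tr (Steinberg F K g)) = \tr (Steinberg F L g).
Proof. by rewrite !mxtrace_Steinberg rmorphB rmorph1 rmorph_nat. Qed.

End SteinbergTrace.

(** * Schur index 1 and irreducibility over Q *)

Section SchurIndexOne.

Variables (gT : finGroupType) (G : {group gT}) (chi : 'CF(G)).

Lemma schur_index_eq1 : chi \is a character -> realizable_in_degree chi 1 ->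
  schur_index chi = 1%N.
Proof.
move=> /schur_indexP[[E [iota [n [rE [_ ->]]]]] min_m] /min_m.
set K := values_field _ _ => le_m1; apply/eqP.
by rewrite eqn_leq le_m1 divn_gt0 ?adim_gt0 // dimvS ?subvf.
Qed.

Hypothesis chi_irr : chi \in irr G.
Let chi_char : chi \is a character.
Proof. by have [i ->] := irrP chi_irr; exact: irr_char. Qed.

(** Extending s to an automorphism of [algC] turns the conjugates of chi into [cfAut] images, which
    are again irreducible. *)
Let aut (s : gal_of (char_field chi)) : {rmorphism algC -> algC} :=
  sval (extend_algC_subfield_aut (cycloC G) s).

Let autE (s : gal_of (char_field chi)) g :
  cycloC G (s (algC_cyclo G (chi g))) = cfAut (aut s) chi g.
Proof.
rewrite cfunE /aut; case: extend_algC_subfield_aut => nu /= ->.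
by rewrite algC_cycloK.
Qed.

(** An s that fixes every value of chi fixes the field they generate, so it is trivial: nontrivial
    conjugates differ from chi. *)
Let cfdot_conj s : '[cfAut (aut s) chi, chi] = (s == 1%g)%:R.
Proof.
have [i Di] := irrP chi_irr.
have [j Dj]: exists j, cfAut (aut s) chi = 'chi_j.
  by apply/irrP; rewrite cfAut_irr.
rewrite Dj [X in '[_, X]]Di cfdot_irr; congr (nat_of_bool _)%:R.
apply/eqP/eqP=> [eq_ji | s1]; last first.
  apply: irr_inj; rewrite -Dj -Di; apply/cfunP=> g.
  by rewrite -autE s1 gal_id algC_cycloK.
have chi_s g : s (algC_cyclo G (chi g)) = algC_cyclo G (chi g).
  by apply: (fmorph_inj (cycloC G)); rewrite autE algC_cycloK // Dj eq_ji -Di.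
apply/eqP/gal_eqP=> a Ka; rewrite gal_id; apply/fixedSpaceP.
apply: subvP Ka; apply/Fadjoin_seqP; split=> [|_ /imageP[g _ ->]].
  exact: sub1v.
exact/fixedSpaceP.
Qed.

Lemma Omega_irreducible n (rG : mx_representation rat G n) :
  schur_index chi = 1%N -> rat_affords rG (Omega chi) -> mx_irreducible rG.
Proof.
move=> m1 rG_Omega.
pose psi := \sum_(s in 'Gal(char_field chi / 1)) cfAut (aut s) chi.
have psi_chi : '[psi, chi] = 1.
  rewrite cfdot_suml (bigD1 1%g) ?group1 //= cfdot_conj eqxx big1 ?addr0 //.
  by move=> s /andP[_ /negPf s1]; rewrite cfdot_conj s1.
pose ch m (r : mx_representation rat G m) :=
  cfRepr (map_repr (ratr : {rmorphism rat -> algC}) r).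
have chE m (r : mx_representation rat G m) g :
    g \in G -> ch m r g = ratr (\tr (r g)).
  by move=> Gg; rewrite cfunE Gg mulr1n map_reprE trace_map_mx.
have ch_psi : ch n rG = psi.
  apply/cfun_inP=> g Gg; rewrite chE // rG_Omega // /Omega m1 mul1r sum_cfunE.
  by apply: eq_bigr => s _; rewrite autE.
have ch_nat m (r : mx_representation rat G m) : '[ch m r, chi] \is a Num.nat.
  exact: Cnat_cfdot_char (cfRepr_char _) chi_char.
(* A rational character is fixed by u, and so is the natural number '[ch m r, chi]. *)
have ch_conj m (r : mx_representation rat G m) (u : {rmorphism algC -> algC}) :
    '[ch m r, cfAut u chi] = '[ch m r, chi].
  have {1}-> : ch m r = cfAut u (ch m r).
    by apply/cfun_inP=> g Gg; rewrite [RHS]cfunE chE // fmorph_rat.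
  rewrite cfdot_aut_char //; have [k ->] := natrP (ch_nat m r).
  exact: rmorph_nat.
have ch_gt0 m (r : mx_representation rat G m)
    m' (r' : mx_representation rat G m') :
    (0 < m)%N -> ch m r + ch m' r' = psi -> 1 <= '[ch m r, chi].
  move=> m_gt0 def_psi.
  have [k Dk] := natrP (ch_nat m r).
  rewrite Dk ler1n lt0n; apply: contraTneq m_gt0 => k0.
  (* If chi did not occur in [ch m r], no conjugate would, so [ch m r] would be orthogonal to psi,
     of which it is a summand: its norm would vanish. *)
  have: '[ch m r] <= '[ch m r, psi].
    rewrite -def_psi cfdotDr lerDl natr_ge0 //.
    by apply: Cnat_cfdot_char; apply: cfRepr_char.
  rewrite cfdot_sumr big1 => [|s _]; last by rewrite ch_conj Dk k0.
  move=> le0; have: '[ch m r] == 0 by rewrite eq_le le0 cfnorm_ge0.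
  rewrite cfnorm_eq0 => /eqP/cfunP/(_ 1%g).
  by rewrite cfRepr1 cfunE => /eqP; rewrite pnatr_eq0 => /eqP->.
apply/mx_irrP; split=> [|U modU nzU].
  rewrite lt0n; apply/eqP=> n0; case/eqP: (oner_neq0 algC).
  rewrite -psi_chi -ch_psi -[RHS](cfdot0l chi); congr '[_, _].
  by apply/eqP; rewrite -char1_eq0 ?cfRepr_char // cfRepr1 n0.
(* For a proper U the quotient is nonzero too, and sub and quotient would each contain chi, which
   psi contains only once. *)
apply: contraT; rewrite -cokermx_eq0 -mxrank_eq0 -lt0n => ltCU.
have def_psi: ch _ (submod_repr modU) + ch _ (factmod_repr modU) = psi.
  apply/cfun_inP=> g Gg; rewrite -ch_psi cfunE !chE //.
  by rewrite -(mxtrace_sub_fact_mod modU) rmorphD.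
have le1: 1 <= '[ch _ (submod_repr modU), chi].
  by apply: ch_gt0 def_psi; rewrite lt0n mxrank_eq0.
have le1': 1 <= '[ch _ (factmod_repr modU), chi].
  by apply: ch_gt0 ltCU _; rewrite addrC; apply: def_psi.
by have := lerD le1 le1'; rewrite -cfdotDl def_psi psi_chi gerDl ler10.
Qed.

End SchurIndexOne.

(** * Fields of values and of realization *)

Lemma values_field_Steinberg_twist (F : finFieldType) (L : fieldExtType rat)
    (u v : {'GL_2[F]} -> L) :
    (forall g, u g = \tr (Steinberg F L g) * v g) ->
    (forall g h, GL2_det g = GL2_det h -> v g = v h) ->
  values_field 'GL_2[F]%G u = values_field 'GL_2[F]%G v.
Proof.
move=> u_v v_det.
have mem_values (w : {'GL_2[F]} -> L) g : w g \in values_field 'GL_2[F]%G w.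
  by apply: seqv_sub_adjoin; apply: image_f; rewrite inE.
have mem_tr (K : {subfield L}) g : \tr (Steinberg F L g) \in K.
  by rewrite mxtrace_Steinberg rpredB ?rpred_nat ?rpred1.
apply/val_inj/eqP; rewrite eqEsubv; apply/andP; split.
  apply/Fadjoin_seqP; split=> [|_ /imageP[g _ ->]]; first exact: sub1v.
  by rewrite u_v; apply: memvM.
apply/Fadjoin_seqP; split=> [|_ /imageP[g _ ->]]; first exact: sub1v.
(* To recover [v g] from the values of u, move to an h of the same determinant, where v agrees and
   the trace can be divided out. *)
have [h [det_h nz_tr]] := exists_det_mxtrace_Steinberg_neq0 (GL2_det g).
have charL : has_pchar0 L by move=> p; rewrite pchar_lalg pchar_num.
rewrite -(v_det h g det_h) -(mulKf (nz_tr L charL) (v h)) -u_v.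
by apply: memvM; rewrite ?memvV.
Qed.

(** Gives a copy of Q(phi) as a number field in its own right, over which a realization has relative
    degree 1. *)
Lemma values_field_exists (gT : finGroupType) (G : {group gT}) (phi : 'CF(G)) :
  exists (E : fieldExtType rat) (iota : {rmorphism E -> algC}) (v : gT -> E),
    {in G, forall g, iota (v g) = phi g} /\ values_field G v = {:E}%AS.
Proof.
have [E [iota [s [Ds genE]]]] := num_field_exists [seq phi g | g in G].
have [p _ iotaK] := num_field_proj iota.
exists E, iota, (fun g => p (phi g)); split=> [g Gg|].
  have: phi g \in map iota s by rewrite Ds image_f.
  by case/mapP=> x _ ->; rewrite iotaK.
apply: val_inj; rewrite /= -[RHS]genE; congr <<1 & _>>%VS.
by rewrite -[RHS](mapK iotaK) Ds -map_comp.
Qed.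

Lemma realizable_in_degree1 (gT : finGroupType) (G : {group gT})
    (chi : 'CF(G)) (E : fieldExtType rat) (iota : {rmorphism E -> algC}) n
    (rE : mx_representation E G n) :
    {in G, forall g, iota (\tr (rE g)) = chi g} ->
    values_field G (fun g => \tr (rE g)) = {:E}%AS ->
  realizable_in_degree chi 1.
Proof.
move=> tr_rE genE; exists E, iota, n, rE; split.
  apply/cfun_inP=> g Gg.
  by rewrite cfunE Gg mulr1n map_reprE trace_map_mx tr_rE.
by rewrite genE divnn adim_gt0.
Qed.

(** * The twist of St by mu o det *)

Section Twist.

Variables (F : finFieldType) (mu : 'CF([set: {unit F}])).
Hypothesis lin_mu : mu \is a linear_char.

Let lambda := cfRepr (mu_det_repr lin_mu).
Let chi := cfRepr (prod_repr (Steinberg F algC) (mu_det_repr lin_mu)).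

Let lambdaE g : lambda g = mu (GL2_det g).
Proof. by rewrite cfunE inE mulr1n mxtrace_scalar. Qed.

Let chiE g : chi g = \tr (Steinberg F algC g) * lambda g.
Proof. by rewrite !cfunE inE !mulr1n mxtrace_prod. Qed.

Lemma schur_index_twist : schur_index lambda = 1%N /\ schur_index chi = 1%N.
Proof.
have [E [iota [v [iota_v genE]]]] := values_field_exists lambda.
have v_lam g : iota (v g) = lambda g by apply: iota_v; rewrite inE.
(* A linear character is its own 1 x 1 representation over its field of values; multiplicativity is
   checked in [algC]. *)
have v_repr : mx_repr 'GL_2[F] (fun g => (v g)%:M : 'M_1).
  have [lam1 lamM] := mu_det_mx_repr lin_mu.
  split=> [|g h Gg Gh]; apply: (map_mx_inj (f := iota)).
    by rewrite map_scalar_mx v_lam lambdaE lam1 map_mx1.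
  by rewrite map_mxM !map_scalar_mx !v_lam !lambdaE lamM.
pose rE := MxRepresentation v_repr.
have tr_rE g : \tr (rE g) = v g by rewrite mxtrace_scalar.
have tr_StrE g :
    \tr (prod_repr (Steinberg F E) rE g) = \tr (Steinberg F E g) * v g.
  by rewrite -tr_rE -mxtrace_prod.
have v_det g h : GL2_det g = GL2_det h -> v g = v h.
  by move=> eq_det; apply: (fmorph_inj iota); rewrite !v_lam !lambdaE eq_det.
split; apply: schur_index_eq1; rewrite ?cfRepr_char //.
  apply: (realizable_in_degree1 (iota := iota) (rE := rE)) => [g _|].
    by rewrite tr_rE v_lam.
  rewrite -genE; apply/val_inj; congr <<1 & _>>%VS.
  by apply: eq_map => g; rewrite tr_rE.
apply: (realizable_in_degree1 (iota := iota)
          (rE := prod_repr (Steinberg F E) rE)) => [g _|].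
  by rewrite tr_StrE rmorphM v_lam rmorph_mxtrace_Steinberg chiE.
by rewrite -genE; apply: values_field_Steinberg_twist.
Qed.

(** Equal fields of values give the same Galois group, and each conjugation fixes the integer trace
    of St, which factors out of the sum. *)
Lemma Omega_twist g :
  Omega chi g = \tr (Steinberg F algC g) * Omega lambda g.
Proof.
have [m_lam m_chi] := schur_index_twist.
pose CtoQ := algC_cyclo 'GL_2[F]%G.
have lamK h : cycloC _ (CtoQ (lambda h)) = lambda h.
  exact: algC_cycloK (cfRepr_char _) h.
have chiK h : CtoQ (chi h) =
    \tr (Steinberg F (cyclo 'GL_2[F]%G) h) * CtoQ (lambda h).
  apply: (fmorph_inj (cycloC _)).
  rewrite algC_cycloK ?cfRepr_char // chiE rmorphM lamK.
  by rewrite rmorph_mxtrace_Steinberg.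
have eqK : char_field chi = char_field lambda.
  apply: values_field_Steinberg_twist => // h k eq_det.
  by rewrite !lambdaE eq_det.
rewrite /Omega m_lam m_chi !mul1r eqK mulr_sumr; apply: eq_bigr => s _.
by rewrite -/CtoQ chiK !rmorphM !rmorph_mxtrace_Steinberg.
Qed.

End Twist.

Theorem theorem3 (F : finFieldType) (chi : 'CF('GL_2[F]))
    (chi_irr : chi \in irr 'GL_2[F])
    (chi_deg : chi 1%g = #|F|%:R)
    (mu : 'CF([set: {unit F}])) (lin_mu : mu \is a linear_char)
    (chi_mu : cfRepr (prod_repr (Steinberg F algC) (mu_det_repr lin_mu)) = chi)
    (d : nat) (rho_mu : mx_representation rat 'GL_2[F] d)
    (rho_mu_irr : mx_irreducible rho_mu)
    (rho_mu_char : rat_affords rho_mu (Omega (cfRepr (mu_det_repr lin_mu)))) :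
  mx_irreducible (prod_repr (Steinberg F rat) rho_mu) /\
  rat_affords (prod_repr (Steinberg F rat) rho_mu) (Omega chi).
Proof.
have St_char : rat_affords (prod_repr (Steinberg F rat) rho_mu) (Omega chi).
  move=> g Gg; rewrite -chi_mu Omega_twist -rho_mu_char //.
  rewrite -(rmorph_mxtrace_Steinberg (ratr : {rmorphism rat -> algC})).
  by rewrite -rmorphM -mxtrace_prod.
split=> //; apply: (Omega_irreducible chi_irr) => //.
by rewrite -chi_mu; have [] := schur_index_twist lin_mu.
Qed.
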